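(* Let $G$ be a groupoid, let $A$ be a ring and let $\sigma=(A_g,\sigma_g)_{g\in G}$ be a partial action of $G$ on $A$ such that $A_g$ is $s$-unital for every $g\in G$, $A=\oplus_{e\in G_0}A_e$, and $\sigma$ is of group-type (so that, by definition of group-type, $G$ is connected). Let $G_0':=\{e\in G_0: A_e\neq\{0\}\}$. Then the partial skew groupoid ring $A\rtimes_\sigma G$ is prime if, and only if, there is some $e\in G_0'$ such that $A_e\rtimes_{\sigma^e}G_e^e$ is prime.
   Context: All rings are associative but not necessarily unital; ideals are two-sided. A ring is prime if it has no nonzero ideals $I,J$ with $IJ=\{0\}$. A ring $R$ is $s$-unital if for every $x\in R$ there are $a,b\in R$ with $ax=x=xb$. A groupoid $G$ is a small category in which every morphism is invertible; $G$ also denotes its set of morphisms. Objects are identified with identity morphisms, so the set of objects $G_0$ is a subset of $G$. The maps $s,r:G\to G_0$ are source and range; $gh$ is defined iff $s(g)=r(h)$. $G$ is connected if for all $e,f\in G_0$ there is $g\in G$ with $s(g)=e$ and $r(g)=f$. For $e\in G_0$, $G_e^e:=\{g\in G: s(g)=r(g)=e\}$. A partial action of $G$ on a ring $A$ is a family $\sigma=(A_g,\sigma_g)_{g\in G}$ such that: (i) for each $g\in G$, $A_{r(g)}$ is an ideal of $A$, $A_g$ is an ideal of $A_{r(g)}$, and $\sigma_g:A_{g^{-1}}\to A_g$ is a ring isomorphism; (ii) $\sigma_e=\mathrm{id}_{A_e}$ for $e\in G_0$; (iii) $\sigma_h^{-1}(A_{g^{-1}}\cap A_h)\subseteq A_{(gh)^{-1}}$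 whenever $s(g)=r(h)$; (iv) $\sigma_g(\sigma_h(x))=\sigma_{gh}(x)$ for all $x\in\sigma_h^{-1}(A_{g^{-1}}\cap A_h)$ whenever $s(g)=r(h)$. Here $A=\oplus_{e\in G_0}A_e$ means that $A$ is the internal direct sum of the ideals $A_e$. The partial skew groupoid ring $A\rtimes_\sigma G$ is the set of formal sums $\sum_{g\in G}a_g\delta_g$ with $a_g\in A_g$ zero for all but finitely many $g$, with pointwise addition and multiplication determined by $a_g\delta_g\cdot b_h\delta_h=\sigma_g(\sigma_{g^{-1}}(a_g)b_h)\delta_{gh}$ if $s(g)=r(h)$, and $0$ otherwise (it is associative under the hypotheses here). For $e\in G_0$, $\sigma^e:=(A_h,\sigma_h)_{h\in G_e^e}$ is the restricted partial action of the group $G_e^e$ on $A_e$, and $A_e\rtimes_{\sigma^e}G_e^e$ is the associated partial skew group ring. A partial action of a connected groupoid $G$ on $A$ is of group-type if there exist $e\in G_0$ and morphisms $\{h_f\}_{f\in G_0}$ in $G$ with $s(h_f)=e$, $r(h_f)=f$, $h_e=e$, $A_{h_f^{-1}}=A_e$ and $A_{h_f}=A_f$ for every $f\in G_0$.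
   Formalization: A prime ring is required to be nonzero; with the literal definition the zero ring is prime and the claim fails for A = {0}, where the skew groupoid ring is zero but G_0' is empty. For A ≠ {0} nothing changes. *)

(* Defs.v *)
From HB Require Import structures.
From mathcomp Require Import all_boot all_order all_algebra finmap.
From mathcomp Require Import boolp classical_sets functions.
From mathcomp Require Import monalg.

Set Implicit Arguments.
Unset Strict Implicit.
Unset Printing Implicit Defensive.

Import GRing.Theory.
Local Open Scope classical_set_scope.
Local Open Scope ring_scope.

(* The rings of the library are unital.  Associativity is a separate layer
   because the partial skew groupoid ring of an arbitrary partial action need
   not be associative; it is when all the A_g are s-unital (skew_rmulA). *)
HB.mixin Record Zmodule_isNonAssocRing R of GRing.Zmodule R := {
  rmul : R -> R -> R;
  rmulDl : forall x y z : R, rmul (x + y) z = rmul x z + rmul y z;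
  rmulDr : forall x y z : R, rmul x (y + z) = rmul x y + rmul x z
}.

#[short(type="nonAssocRingType")]
HB.structure Definition NonAssocRing :=
  { R of GRing.Zmodule R & Zmodule_isNonAssocRing R }.

HB.mixin Record NonAssocRing_isRng R of NonAssocRing R := {
  rmulA : forall x y z : R, rmul x (rmul y z) = rmul (rmul x y) z
}.

#[short(type="rngType")]
HB.structure Definition Rng := { R of NonAssocRing R & NonAssocRing_isRng R }.

Notation "x ** y" := (rmul x y) (at level 40, left associativity) : ring_scope.

Section RingTheory.
Variable R : nonAssocRingType.
Implicit Types (B I J : set R) (x y : R).

Definition add_subgroup I := I 0 /\ forall x y, I x -> I y -> I (x - y).

(* I is a two-sided ideal of the subring B *)
Definition ideal_in B I :=
  [/\ I `<=` B, add_subgroup I &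
      forall b x, B b -> I x -> I (b ** x) /\ I (x ** b)].

Definition ideal I := ideal_in setT I.

(* the additive subgroup generated by the products, as usual for ideals *)
Definition ideal_mul I J : set R :=
  [set z | exists (n : nat) (x y : 'I_n -> R),
     (forall i, I (x i) /\ J (y i)) /\ z = \sum_(i < n) x i ** y i].

(* The zero ring is not prime: it is excluded explicitly, since it has no
   nonzero ideals at all. *)
Definition prime_ring :=
  (exists x : R, x <> 0) /\
  ~ exists I J, [/\ ideal I, ideal J, I <> [set 0], J <> [set 0] &
                    ideal_mul I J = [set 0]].

Definition s_unital B :=
  forall x, B x -> exists a b, [/\ B a, B b, a ** x = x & x ** b = x].

Lemma rmul0r x : 0 ** x = 0.
Proof. by apply: (addrI (0 ** x)); rewrite -rmulDl !addr0. Qed.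

Lemma rmulr0 x : x ** 0 = 0.
Proof. by apply: (addrI (x ** 0)); rewrite -rmulDr !addr0. Qed.

Lemma rmulNr x y : (- x) ** y = - (x ** y).
Proof. by apply: (addrI (x ** y)); rewrite -rmulDl !subrr rmul0r. Qed.

Lemma rmulrN x y : x ** (- y) = - (x ** y).
Proof. by apply: (addrI (x ** y)); rewrite -rmulDr !subrr rmulr0. Qed.

Lemma add_subgroupN I x : add_subgroup I -> I x -> I (- x).
Proof. by case=> I0 IB Ix; rewrite -sub0r; apply: IB. Qed.

Lemma add_subgroupD I x y : add_subgroup I -> I x -> I y -> I (x + y).
Proof.
move=> sI Ix Iy; rewrite -[y]opprK; case: (sI) => _; apply=> //.
exact: add_subgroupN.
Qed.

Lemma ideal_add B I : ideal_in B I -> add_subgroup I.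
Proof. by case. Qed.

End RingTheory.

(* An ideal of a ring, as a ring. *)
Section IdealRing.
Variables (A : rngType) (I : set A) (idI : ideal I).

Record ideal_ring (hI : ideal I) : predArgType := IdealRing {
  ideal_val :> A;
  _ : `[< I ideal_val >]
}.

HB.instance Definition _ hI := [isSub for @ideal_val hI].
HB.instance Definition _ hI := [Choice of ideal_ring hI by <:].

Local Notation T := (ideal_ring idI).
Implicit Types x y z : T.

Lemma ideal_ringP x : I (val x).
Proof. exact/asboolP/(valP x). Qed.

Definition to_ideal (a : A) (Ia : I a) : T := IdealRing idI (introT (asboolP _) Ia).

Let sI : add_subgroup I := ideal_add idI.

Definition ideal_zero : T := to_ideal (proj1 sI).
Definition ideal_opp x : T := to_ideal (add_subgroupN sI (ideal_ringP x)).
Definition ideal_plus x y : T :=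
  to_ideal (add_subgroupD sI (ideal_ringP x) (ideal_ringP y)).

Fact ideal_plusA : associative ideal_plus.
Proof. by move=> x y z; apply: val_inj; rewrite /= addrA. Qed.

Fact ideal_plusC : commutative ideal_plus.
Proof. by move=> x y; apply: val_inj; rewrite /= addrC. Qed.

Fact ideal_plus0 : left_id ideal_zero ideal_plus.
Proof. by move=> x; apply: val_inj; rewrite /= add0r. Qed.

Fact ideal_plusN : left_inverse ideal_zero ideal_opp ideal_plus.
Proof. by move=> x; apply: val_inj; rewrite /= addNr. Qed.

HB.instance Definition _ := GRing.isZmodule.Build T
  ideal_plusA ideal_plusC ideal_plus0 ideal_plusN.

Fact ideal_rmul_subproof x y : I (val x ** val y).
Proof.
have [_ _ idM] := idI.
by have [] := idM (val x) (val y) Logic.I (ideal_ringP y).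
Qed.

Definition ideal_rmul x y : T := to_ideal (ideal_rmul_subproof x y).

Fact ideal_rmulDl x y z :
  ideal_rmul (x + y) z = ideal_rmul x z + ideal_rmul y z.
Proof. by apply: val_inj; rewrite /= rmulDl. Qed.

Fact ideal_rmulDr x y z :
  ideal_rmul x (y + z) = ideal_rmul x y + ideal_rmul x z.
Proof. by apply: val_inj; rewrite /= rmulDr. Qed.

HB.instance Definition _ :=
  Zmodule_isNonAssocRing.Build T ideal_rmulDl ideal_rmulDr.

Fact ideal_rmulA x y z : x ** (y ** z) = (x ** y) ** z.
Proof. by apply: val_inj; rewrite /= rmulA. Qed.

HB.instance Definition _ := NonAssocRing_isRng.Build T ideal_rmulA.

End IdealRing.

(* Groupoids by their morphisms, the objects being the identity morphisms.
   gcomp is total; its value is irrelevant unless src g = rng h. *)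
HB.mixin Record Choice_isGroupoid G of Choice G := {
  src : G -> G;
  rng : G -> G;
  gcomp : G -> G -> G;
  ginv : G -> G;
  src_src : forall g, src (src g) = src g;
  rng_src : forall g, rng (src g) = src g;
  src_rng : forall g, src (rng g) = rng g;
  rng_rng : forall g, rng (rng g) = rng g;
  src_comp : forall g h, src g = rng h -> src (gcomp g h) = src h;
  rng_comp : forall g h, src g = rng h -> rng (gcomp g h) = rng g;
  gcompA : forall g h k, src g = rng h -> src h = rng k ->
    gcomp g (gcomp h k) = gcomp (gcomp g h) k;
  gcomp_src : forall g, gcomp g (src g) = g;
  gcomp_rng : forall g, gcomp (rng g) g = g;
  src_inv : forall g, src (ginv g) = rng g;
  rng_inv : forall g, rng (ginv g) = src g;
  gcompV : forall g, gcomp g (ginv g) = rng g;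
  gcompVg : forall g, gcomp (ginv g) g = src g
}.

#[short(type="groupoidType")]
HB.structure Definition Groupoid := { G of Choice G & Choice_isGroupoid G }.

Section Groupoid.
Variable G : groupoidType.

(* G_0, as a subtype of G *)
Record gobj : predArgType := Gobj { gobj_val :> G; _ : src gobj_val == gobj_val }.

HB.instance Definition _ := [isSub for gobj_val].
HB.instance Definition _ := [Choice of gobj by <:].

Definition gconnected :=
  forall e f : gobj, exists g : G, src g = e /\ rng g = f.

Lemma src_obj (e : gobj) : src e = e :> G.
Proof. exact/eqP/(valP e). Qed.

Lemma rng_obj (e : gobj) : rng e = e :> G.
Proof. by rewrite -src_obj rng_src. Qed.

Lemma ginvK (g : G) : ginv (ginv g) = g.
Proof.
have sVV : src (ginv (ginv g)) = rng (ginv g) by rewrite src_inv.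
have sV : src (ginv g) = rng g by rewrite src_inv.
rewrite -[LHS]gcomp_src src_inv rng_inv -(gcompVg g) gcompA //.
by rewrite gcompVg src_inv gcomp_rng.
Qed.

Lemma ginv_src (g : G) : ginv (src g) = src g.
Proof.
rewrite -[LHS]gcomp_src src_inv rng_src.
have := gcompVg (src g); rewrite src_src.
by [].
Qed.

Lemma ginv_comp (g h : G) : src g = rng h ->
  ginv (gcomp g h) = gcomp (ginv h) (ginv g).
Proof.
move=> gh; set k := gcomp g h; set l := gcomp _ _.
have hg : src (ginv h) = rng (ginv g) by rewrite src_inv rng_inv.
have sl : src l = rng k by rewrite /l /k src_comp // src_inv rng_comp.
have kl : gcomp l k = src k.
  rewrite /k gcompA; [|by rewrite sl rng_comp|by []].
  rewrite /l -(gcompA (ginv h)) //; last by rewrite src_inv.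
  by rewrite gcompVg gh -src_inv gcomp_src gcompVg src_comp.
rewrite -[LHS]gcomp_rng rng_inv -kl -gcompA //; last by rewrite rng_inv.
by rewrite gcompV -sl gcomp_src.
Qed.

End Groupoid.

(* The isotropy group G_e^e, as a groupoid. *)
Section Isotropy.
Variables (G : groupoidType) (e : gobj G).

Record isotropy : predArgType := Isotropy {
  iso_val :> G;
  _ : (src iso_val == val e) && (rng iso_val == val e)
}.

HB.instance Definition _ := [isSub for iso_val].
HB.instance Definition _ := [Choice of isotropy by <:].

Lemma iso_src (g : isotropy) : src (g : G) = val e.
Proof. by case/andP: (valP g) => /eqP. Qed.

Lemma iso_rng (g : isotropy) : rng (g : G) = val e.
Proof. by case/andP: (valP g) => _ /eqP. Qed.

Fact iso_id_subproof : (src (val e) == val e) && (rng (val e) == val e).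
Proof. by rewrite src_obj rng_obj eqxx. Qed.

Definition iso_id : isotropy := Isotropy iso_id_subproof.

Fact iso_inv_subproof (g : isotropy) :
  (src (ginv (g : G)) == val e) && (rng (ginv (g : G)) == val e).
Proof. by rewrite src_inv rng_inv iso_src iso_rng eqxx. Qed.

Definition iso_inv (g : isotropy) : isotropy := Isotropy (iso_inv_subproof g).

Fact iso_comp_subproof (g h : isotropy) :
  (src (gcomp (g : G) h) == val e) && (rng (gcomp (g : G) h) == val e).
Proof. by rewrite src_comp ?rng_comp ?iso_src ?iso_rng ?eqxx. Qed.

Definition iso_comp (g h : isotropy) : isotropy :=
  Isotropy (iso_comp_subproof g h).

Let id_ (g : isotropy) := iso_id.

Fact isotropy_groupoid : Choice_isGroupoid isotropy.
Proof.
apply: (@Choice_isGroupoid.Build isotropy id_ id_ iso_comp iso_inv) => //.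
- move=> g h k _ _; apply: val_inj => /=.
  by rewrite gcompA ?iso_src ?iso_rng.
- by move=> g; apply: val_inj; rewrite /= -[X in gcomp _ X](iso_src g) gcomp_src.
- by move=> g; apply: val_inj; rewrite /= -[X in gcomp X _](iso_rng g) gcomp_rng.
- by move=> g; apply: val_inj; rewrite /= gcompV iso_rng.
- by move=> g; apply: val_inj; rewrite /= gcompVg iso_src.
Defined.

HB.instance Definition _ := isotropy_groupoid.

End Isotropy.

(* pdom g is A_g and pact g is sigma_g, whose values outside of A_{g^-1} are
   irrelevant. *)
Record partial_action (G : groupoidType) (A : rngType) := PartialAction {
  pdom : G -> set A;
  pact : G -> A -> A;
  pdom_rng_ideal : forall g, ideal (pdom (rng g));
  pdom_ideal : forall g, ideal_in (pdom (rng g)) (pdom g);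
  pact_bij : forall g, set_bij (pdom (ginv g)) (pdom g) (pact g);
  pactD : forall g x y, pdom (ginv g) x -> pdom (ginv g) y ->
    pact g (x + y) = pact g x + pact g y;
  pactM : forall g x y, pdom (ginv g) x -> pdom (ginv g) y ->
    pact g (x ** y) = pact g x ** pact g y;
  pact_obj : forall (e : gobj G) x, pdom e x -> pact e x = x;
  pdom_comp : forall g h, src g = rng h ->
    pdom (ginv h) `&` pact h @^-1` (pdom (ginv g) `&` pdom h)
      `<=` pdom (ginv (gcomp g h));
  pact_comp : forall g h x, src g = rng h ->
    (pdom (ginv h) `&` pact h @^-1` (pdom (ginv g) `&` pdom h)) x ->
    pact g (pact h x) = pact (gcomp g h) x
}.

Section PartialAction.
Variables (G : groupoidType) (A : rngType) (sigma : partial_action G A).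
Implicit Types (g h : G) (x y : A).
Local Notation D := (pdom sigma).
Local Notation s := (pact sigma).

Lemma pdom_obj_ideal (e : gobj G) : ideal (D e).
Proof. by rewrite -rng_obj; apply: pdom_rng_ideal. Qed.

Lemma pdom_add g : add_subgroup (D g).
Proof. exact: ideal_add (pdom_ideal sigma g). Qed.

Lemma pdom_sub g x : D g x -> D (rng g) x.
Proof. by case: (pdom_ideal sigma g) => + _ _; apply. Qed.

Lemma pact_dom g x : D (ginv g) x -> D g (s g x).
Proof. by case: (pact_bij sigma g) => + _ _ => h Dx; apply: h. Qed.

Lemma pactV_dom g x : D g x -> D (ginv g) (s (ginv g) x).
Proof. by move=> Dx; apply: pact_dom; rewrite ginvK. Qed.

Lemma pact_src g x : D (src g) x -> s (src g) x = x.
Proof.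
by move=> Dx; apply: (pact_obj (e := Gobj (introT eqP (src_src g)))).
Qed.

Lemma pactKV g x : D g x -> s g (s (ginv g) x) = x.
Proof.
move=> Dx; rewrite pact_comp ?rng_inv //.
  by rewrite gcompV -src_inv pact_src // src_inv; apply: pdom_sub.
by rewrite ginvK; split=> //=; split; apply: pactV_dom.
Qed.

Lemma pactK g x : D (ginv g) x -> s (ginv g) (s g x) = x.
Proof. by move=> Dx; rewrite -{2}[g]ginvK pactKV. Qed.

(* sigma_g (A_{g^-1} n A_h) is contained in A_{gh} *)
Lemma pact_dom_comp g h x : src g = rng h ->
  D (ginv g) x -> D h x -> D (gcomp g h) (s g x).
Proof.
move=> gh Dgx Dhx.
have := @pdom_comp _ _ sigma (ginv h) (ginv g).
rewrite src_inv rng_inv => /(_ (esym gh) (s g x)).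
rewrite -ginv_comp // !ginvK; apply; split; first exact: pact_dom.
by rewrite /= pactK.
Qed.

Lemma pact0 g : s g 0 = 0.
Proof.
have D0 : D (ginv g) 0 by case: (pdom_add (ginv g)).
by apply: (addrI (s g 0)); rewrite -pactD // !addr0.
Qed.

Lemma pdom_mul g h x y : src g = rng h -> D (ginv g) x -> D h y ->
  D (ginv g) (x ** y) /\ D h (x ** y).
Proof.
move=> gh Dx Dy.
case: (pdom_ideal sigma (ginv g)) => _ _ /(_ y x) [||_ ?] //.
  by rewrite rng_inv gh; apply: pdom_sub.
case: (pdom_ideal sigma h) => _ _ /(_ x y) [||? _] //.
by rewrite -gh -rng_inv; apply: pdom_sub.
Qed.

Definition skew_coef g h x y : A := s g (s (ginv g) x ** y).

Lemma skew_coef_dom g h x y : src g = rng h -> D g x -> D h y ->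
  D (gcomp g h) (skew_coef g h x y).
Proof.
move=> gh /pactV_dom Dx Dy; have [? ?] := pdom_mul gh Dx Dy.
exact: pact_dom_comp.
Qed.

End PartialAction.

(* sigma^e = (A_h, sigma_h) for h in G_e^e, a partial action of the group
   G_e^e on the ring A_e. *)
Section Restriction.
Variables (G : groupoidType) (A : rngType) (sigma : partial_action G A).
Variable e : gobj G.
Local Notation D := (pdom sigma).
Local Notation s := (pact sigma).

Definition obj_ring := ideal_ring (pdom_obj_ideal sigma e).

HB.instance Definition _ := SubType.on obj_ring.
HB.instance Definition _ := Rng.on obj_ring.

Implicit Types (g h : isotropy e) (x y : obj_ring).

Definition res_dom g : set obj_ring := [set x | D (val g) (val x)].

Definition res_act g x : obj_ring := insubd (0 : obj_ring) (s (val g) (val x)).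

Lemma pdom_iso g (a : A) : D (val g) a -> D (val e) a.
Proof. by move=> /pdom_sub; rewrite iso_rng. Qed.

Lemma val_res_act g x : res_dom (ginv g) x ->
  val (res_act g x) = s (val g) (val x).
Proof.
move=> Dx; rewrite /res_act val_insubd.
by have /pact_dom/pdom_iso/asboolP -> := Dx.
Qed.

Fact res_rng_ideal g : ideal (res_dom (rng g)).
Proof.
split; first by []; first split.
- by have [_ [? _] _] := pdom_obj_ideal sigma e.
- move=> x y; rewrite /res_dom /=.
  by have [_ [_ +] _] := pdom_obj_ideal sigma e; apply.
- by move=> x y _ _; split; exact: ideal_ringP.
Qed.

Fact res_ideal g : ideal_in (res_dom (rng g)) (res_dom g).
Proof.
split; first by move=> x _; exact: ideal_ringP.
- split; first by have [? _] := pdom_add sigma (val g).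
  by move=> x y; have [_ +] := pdom_add sigma (val g); apply.
- move=> x y _ Dy; have [_ _] := pdom_ideal sigma (val g); apply=> //.
  by rewrite iso_rng; exact: ideal_ringP.
Qed.

Fact res_bij g : set_bij (res_dom (ginv g)) (res_dom g) (res_act g).
Proof.
split.
- by move=> x Dx; rewrite /res_dom /= val_res_act //; apply: pact_dom.
- move=> x y; rewrite !inE => Dx Dy /(congr1 val).
  rewrite !val_res_act // => /(congr1 (s (ginv (val g)))).
  by rewrite !pactK // => ?; apply: val_inj.
- move=> x Dx; have Dy : D (ginv (val g)) (s (ginv (val g)) (val x)).
    exact: pactV_dom.
  exists (to_ideal (pdom_obj_ideal sigma e) (@pdom_iso (ginv g) _ Dy)) => //.
  by apply: val_inj; rewrite val_res_act //= pactKV.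
Qed.

Fact res_actD g x y : res_dom (ginv g) x -> res_dom (ginv g) y ->
  res_act g (x + y) = res_act g x + res_act g y.
Proof.
move=> Dx Dy; apply: val_inj; rewrite [RHS]/= !val_res_act //; first exact: pactD.
exact: add_subgroupD (pdom_add _ _) Dx Dy.
Qed.

Fact res_actM g x y : res_dom (ginv g) x -> res_dom (ginv g) y ->
  res_act g (x ** y) = res_act g x ** res_act g y.
Proof.
move=> Dx Dy; apply: val_inj; rewrite [RHS]/= !val_res_act //; first exact: pactM.
have [_ _ /(_ (val x) (val y))] := pdom_ideal sigma (val (ginv g)).
by case=> //; rewrite iso_rng; exact: ideal_ringP.
Qed.

Fact res_act_obj (u : gobj (isotropy e)) x : 
  res_dom (val u) x -> res_act (val u) x = x.
Proof.
have -> : val u = iso_id e :> isotropy e by exact: (esym (src_obj u)).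
move=> Dx; apply: val_inj; rewrite val_res_act; first exact: pact_obj.
by rewrite /res_dom /= -[X in ginv X]src_obj ginv_src src_obj.
Qed.

Fact res_dom_comp g h : src g = rng h ->
  res_dom (ginv h) `&` res_act h @^-1` (res_dom (ginv g) `&` res_dom h)
    `<=` res_dom (ginv (gcomp g h)).
Proof.
move=> _ x [Dx []]; rewrite /res_dom /= val_res_act // => Dg Dh.
by apply: (@pdom_comp _ _ sigma (val g) (val h)); rewrite ?iso_src ?iso_rng.
Qed.

Fact res_act_comp g h x : src g = rng h ->
  (res_dom (ginv h) `&` res_act h @^-1` (res_dom (ginv g) `&` res_dom h)) x ->
  res_act g (res_act h x) = res_act (gcomp g h) x.
Proof.
move=> gh Dhx; have Dghx := res_dom_comp gh Dhx.
have [Dx [Dg Dh]] := Dhx; apply: val_inj; rewrite !val_res_act //.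
rewrite pact_comp ?iso_src ?iso_rng //; split=> //.
by move: Dg Dh; rewrite /res_dom /= val_res_act.
Qed.

Definition restriction : partial_action (isotropy e) obj_ring :=
  PartialAction res_rng_ideal res_ideal res_bij res_actD res_actM res_act_obj
    res_dom_comp res_act_comp.

End Restriction.

(* The partial skew groupoid ring: the formal sums with coefficient at g
   in A_g; << a *g g >> is a delta_g. *)
Section SkewRing.
Variables (G : groupoidType) (A : rngType) (sigma : partial_action G A).
Local Notation D := (pdom sigma).
Local Notation s := (pact sigma).

Record skew_ring : predArgType := SkewRing {
  skew_val :> {malg A[G]};
  _ : `[< forall g, D g skew_val@_g >]
}.

HB.instance Definition _ := [isSub for skew_val].
HB.instance Definition _ := [Choice of skew_ring by <:].

Implicit Types (x y z : skew_ring) (g h k : G) (a b c : A).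

Lemma skew_ringP x g : D g (val x)@_g.
Proof. by have /asboolP := valP x; apply. Qed.

Definition to_skew (u : {malg A[G]}) (Du : forall g, D g u@_g) : skew_ring :=
  SkewRing (introT (asboolP _) Du).

Fact skew_zero_subproof g : D g (0 : {malg A[G]})@_g.
Proof. by rewrite mcoeff0; case: (pdom_add sigma g). Qed.

Fact skew_opp_subproof x g : D g (- val x)@_g.
Proof.
by rewrite mcoeffN; apply: add_subgroupN (pdom_add _ _) (skew_ringP _ _).
Qed.

Fact skew_plus_subproof x y g : D g (val x + val y)@_g.
Proof.
rewrite mcoeffD.
exact: add_subgroupD (pdom_add _ _) (skew_ringP _ _) (skew_ringP _ _).
Qed.

Definition skew_zero := to_skew skew_zero_subproof.
Definition skew_opp x := to_skew (skew_opp_subproof x).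
Definition skew_plus x y := to_skew (skew_plus_subproof x y).

Fact skew_plusA : associative skew_plus.
Proof. by move=> x y z; apply: val_inj; rewrite /= addrA. Qed.

Fact skew_plusC : commutative skew_plus.
Proof. by move=> x y; apply: val_inj; rewrite /= addrC. Qed.

Fact skew_plus0 : left_id skew_zero skew_plus.
Proof. by move=> x; apply: val_inj; rewrite /= add0r. Qed.

Fact skew_plusN : left_inverse skew_zero skew_opp skew_plus.
Proof. by move=> x; apply: val_inj; rewrite /= addNr. Qed.

HB.instance Definition _ := GRing.isZmodule.Build skew_ring
  skew_plusA skew_plusC skew_plus0 skew_plusN.

(* the biadditive extension of
   a delta_g . b delta_h = sigma_g (sigma_{g^-1} (a) b) delta_{gh} *)
Definition malg_mul (u v : {malg A[G]}) : {malg A[G]} :=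
  \sum_(g <- msupp u) \sum_(h <- msupp v | src g == rng h)
    << skew_coef sigma g h u@_g v@_h *g gcomp g h >>.

Lemma skew_coef0l g h b : skew_coef sigma g h 0 b = 0.
Proof. by rewrite /skew_coef pact0 rmul0r pact0. Qed.

Lemma skew_coef0r g h a : skew_coef sigma g h a 0 = 0.
Proof. by rewrite /skew_coef rmulr0 pact0. Qed.

Lemma malg_mulEw (X Y : {fset G}) (u v : {malg A[G]}) :
  (msupp u `<=` X)%fset -> (msupp v `<=` Y)%fset ->
  malg_mul u v = \sum_(g <- X) \sum_(h <- Y | src g == rng h)
    << skew_coef sigma g h u@_g v@_h *g gcomp g h >>.
Proof.
move=> uX vY; rewrite /malg_mul (big_fset_incl _ uX) /=; last first.
  move=> g _ /mcoeff_outdom ->; rewrite big1 // => h _.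
  by rewrite skew_coef0l monalgU0.
apply: eq_bigr => g _; rewrite big_mkcond [RHS]big_mkcond /=.
apply: (big_fset_incl _ vY) => h _ /mcoeff_outdom ->.
by rewrite skew_coef0r monalgU0 if_same.
Qed.

Fact skew_mul_subproof x y g : D g (malg_mul (val x) (val y))@_g.
Proof.
have [D0 _] := pdom_add sigma g.
have DD := add_subgroupD (pdom_add sigma g).
rewrite /malg_mul raddf_sum; apply: big_ind => // h _.
rewrite raddf_sum; apply: big_ind => // k /eqP hk.
rewrite /= mcoeffU; case: eqP => [<-|//]; rewrite mulr1n.
exact: skew_coef_dom (skew_ringP _ _) (skew_ringP _ _).
Qed.

Definition skew_mul x y := to_skew (skew_mul_subproof x y).

Lemma skew_coefDl g h a a' b : src g = rng h -> D g a -> D g a' -> D h b ->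
  skew_coef sigma g h (a + a') b =
    skew_coef sigma g h a b + skew_coef sigma g h a' b.
Proof.
move=> gh Da Da' Db; rewrite /skew_coef pactD ?ginvK // rmulDl pactD //.
- by case: (pdom_mul gh (pactV_dom Da) Db).
- by case: (pdom_mul gh (pactV_dom Da') Db).
Qed.

Lemma skew_coefDr g h a b b' : src g = rng h -> D g a -> D h b -> D h b' ->
  skew_coef sigma g h a (b + b') =
    skew_coef sigma g h a b + skew_coef sigma g h a b'.
Proof.
move=> gh Da Db Db'; rewrite /skew_coef rmulDr pactD //.
- by case: (pdom_mul gh (pactV_dom Da) Db).
- by case: (pdom_mul gh (pactV_dom Da) Db').
Qed.

Fact skew_mulDl x y z : skew_mul (x + y) z = skew_mul x z + skew_mul y z.
Proof.
apply: val_inj => /=; set X := (msupp (val x) `|` msupp (val y))%fset.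
rewrite (malg_mulEw (X := X) (msuppD_le _ _) (fsubset_refl _)).
rewrite (malg_mulEw (fsubsetUl _ _ : (_ `<=` X)%fset) (fsubset_refl _)).
rewrite (malg_mulEw (fsubsetUr _ _ : (_ `<=` X)%fset) (fsubset_refl _)).
rewrite -big_split; apply: eq_bigr => g _ /=.
rewrite -big_split; apply: eq_bigr => h /eqP gh /=.
by rewrite mcoeffD skew_coefDl ?monalgUD //; exact: skew_ringP.
Qed.

Fact skew_mulDr x y z : skew_mul x (y + z) = skew_mul x y + skew_mul x z.
Proof.
apply: val_inj => /=; set X := (msupp (val y) `|` msupp (val z))%fset.
rewrite (malg_mulEw (Y := X) (fsubset_refl _) (msuppD_le _ _)).
rewrite (malg_mulEw (fsubset_refl _) (fsubsetUl _ _ : (_ `<=` X)%fset)).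
rewrite (malg_mulEw (fsubset_refl _) (fsubsetUr _ _ : (_ `<=` X)%fset)).
rewrite -big_split; apply: eq_bigr => g _ /=.
rewrite -big_split; apply: eq_bigr => h /eqP gh /=.
by rewrite mcoeffD skew_coefDr ?monalgUD //; exact: skew_ringP.
Qed.

HB.instance Definition _ :=
  Zmodule_isNonAssocRing.Build skew_ring skew_mulDl skew_mulDr.

End SkewRing.

Section Associativity.
Variables (G : groupoidType) (A : rngType) (sigma : partial_action G A).
Hypothesis su : forall g, s_unital (pdom sigma g).
Local Notation D := (pdom sigma).
Local Notation s := (pact sigma).
Implicit Types (x y z : skew_ring sigma) (g h k : G) (a b c : A).

Lemma s_unital2 g a b : D g a -> D g b ->
  exists u, [/\ D g u, u ** a = a & u ** b = b].
Proof.
move=> Da Db; have [_ sI idM] := pdom_ideal sigma g.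
have DM c d : D g c -> D g d -> D g (c ** d).
  by move=> /pdom_sub Dc Dd; case: (idM c d).
have [u [_ [Du _ ua _]]] := su Da.
have Dd : D g (b - u ** b) by case: sI => _; apply=> //; apply: DM.
have [v [_ [Dv _ vd _]]] := su Dd.
exists (u + v - v ** u); split.
- by case: (sI) => _; apply; [apply: add_subgroupD|apply: DM].
- by rewrite !rmulDl rmulNr -rmulA ua addrK.
- move: vd; rewrite rmulDr rmulrN => vd.
  by rewrite !rmulDl rmulNr -rmulA -addrA vd addrC subrK.
Qed.

Lemma skew_coefA g h k a b c : src g = rng h -> src h = rng k ->
    D g a -> D h b -> D k c ->
  skew_coef sigma g (gcomp h k) a (skew_coef sigma h k b c) =
  skew_coef sigma (gcomp g h) k (skew_coef sigma g h a b) c.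
Proof.
move=> gh hk Da Db Dc; rewrite /skew_coef.
set x := s (ginv g) a; set b' := s (ginv h) b.
have Dx : D (ginv g) x by apply: pactV_dom.
have Db' : D (ginv h) b' by apply: pactV_dom.
have [Dgxb Dhxb] := pdom_mul gh Dx Db.
pose y := s (ginv h) (x ** b).
have Dhy : D (ginv h) y by apply: pactV_dom.
have hy : s h y = x ** b by apply: pactKV.
have Dghy : D (ginv (gcomp g h)) y.
  by apply: pdom_comp => //; split=> //=; rewrite hy.
have ghy : s (gcomp g h) y = s g (x ** b).
  by rewrite -hy pact_comp //; split=> //=; rewrite hy.
rewrite -ghy pactK //.
have [Dhbc Dkbc] := pdom_mul hk Db' Dc.
set w := s h (b' ** c); have Dw : D h w by apply: pact_dom.
have [u [Du ub uw]] := s_unital2 Db Dw.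
have [Dgxu Dhxu] := pdom_mul gh Dx Du.
have [Dhyc Dkyc] := pdom_mul hk Dhy Dc.
have DV a' : D h a' -> D (ginv (ginv h)) a' by rewrite ginvK.
have xw : x ** w = s h (y ** c).
  rewrite -uw rmulA -[x ** u](pactKV Dhxu) /w -pactM //; last exact: pactV_dom.
  rewrite rmulA -pactM; [|exact: DV..].
  by rewrite -rmulA ub.
have [Dgxw Dhxw] := pdom_mul gh Dx Dw.
rewrite xw pact_comp //; split=> //=; rewrite -xw //.
Qed.

Definition skew_delta g a : skew_ring sigma := insubd (0 : skew_ring sigma) << a *g g >>.

Lemma val_skew_delta g a : D g a -> val (skew_delta g a) = << a *g g >>.
Proof.
move=> Da; rewrite /skew_delta val_insubd; case: asboolP => // -[] h.
rewrite mcoeffU; case: eqP => [<-|_]; rewrite ?mulr1n ?mulr0n //.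
by case: (pdom_add sigma h).
Qed.

Lemma skew_deltaM g h a b : D g a -> D h b ->
  skew_delta g a ** skew_delta h b =
  if src g == rng h then skew_delta (gcomp g h) (skew_coef sigma g h a b) else 0.
Proof.
move=> Da Db; apply: val_inj => /=.
rewrite !val_skew_delta // (malg_mulEw _ msuppU_le msuppU_le).
rewrite big_seq_fset1 big_mkcond big_seq_fset1 !mcoeffUU.
by case: eqP => // gh; rewrite val_skew_delta //; apply: skew_coef_dom.
Qed.

Lemma skewE x : x = \sum_(g <- msupp (val x)) skew_delta g (val x)@_g.
Proof.
have val_sum (r : seq G) (F : G -> skew_ring sigma) :
    val (\sum_(g <- r) F g) = \sum_(g <- r) val (F g).
  by elim: r => [|g r IH]; rewrite ?big_nil // !big_cons /= -IH.
apply: val_inj; rewrite val_sum [LHS](monalgEw (fsubset_refl _)).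
by apply: eq_bigr => g _; rewrite val_skew_delta //; apply: skew_ringP.
Qed.

Lemma skew_rmulA x y z : x ** (y ** z) = (x ** y) ** z.
Proof.
have suml (F : G -> skew_ring sigma) (r : seq G) u :
    (\sum_(g <- r) F g) ** u = \sum_(g <- r) F g ** u.
  by elim: r => [|g r IH]; rewrite ?big_nil ?rmul0r // !big_cons rmulDl IH.
have sumr (F : G -> skew_ring sigma) (r : seq G) u :
    u ** (\sum_(g <- r) F g) = \sum_(g <- r) u ** F g.
  by elim: r => [|g r IH]; rewrite ?big_nil ?rmulr0 // !big_cons rmulDr IH.
rewrite (skewE x) !suml; apply: eq_bigr => g _.
rewrite (skewE y) suml !sumr suml; apply: eq_bigr => h _.
rewrite (skewE z) !sumr; apply: eq_bigr => k _.
have Da := skew_ringP x g; have Db := skew_ringP y h.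
have Dc := skew_ringP z k.
rewrite !(skew_deltaM Da Db, skew_deltaM Db Dc).
have [gh|gh] := eqVneq (src g) (rng h); have [hk|hk] := eqVneq (src h) (rng k).
- rewrite !skew_deltaM ?rng_comp ?src_comp ?gh ?hk ?eqxx //; last 2 first.
  + exact: skew_coef_dom.
  + exact: skew_coef_dom.
  by rewrite skew_coefA // gcompA.
- rewrite rmulr0 skew_deltaM ?src_comp ?(negbTE hk) //; exact: skew_coef_dom.
- rewrite rmul0r skew_deltaM ?rng_comp ?(negbTE gh) //; exact: skew_coef_dom.
- by rewrite rmul0r rmulr0.
Qed.

End Associativity.

(* A is the internal direct sum of its ideals A_e, e in G_0. *)
Definition object_direct_sum (G : groupoidType) (A : rngType)
    (sigma : partial_action G A) :=
  forall a : A, exists! u : {malg A[gobj G]},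
    (forall e : gobj G, pdom sigma e u@_e) /\ a = \sum_(e <- msupp u) u@_e.

Definition group_type (G : groupoidType) (A : rngType)
    (sigma : partial_action G A) :=
  gconnected G /\
  exists (e : gobj G) (h : gobj G -> G),
    [/\ forall f, src (h f) = e, forall f, rng (h f) = f, h e = e,
        forall f, pdom sigma (ginv (h f)) = pdom sigma e
      & forall f, pdom sigma (h f) = pdom sigma f].

(* Main.v *)
Require Import Defs.
From mathcomp Require Import all_boot all_order all_algebra.
From mathcomp Require Import boolp classical_sets.
From mathcomp Require Import finmap monalg.

Set Implicit Arguments.
Unset Strict Implicit.
Unset Printing Implicit Defensive.

Local Open Scope classical_set_scope.
Local Open Scope ring_scope.

Import GRing.Theory.

(** Primeness can be tested on elements: an associative ring is prime iff it is
    nonzero and x y = 0, x R y = 0 force x = 0 or y = 0 (prime_ringP).  Write S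
    for the partial skew groupoid ring and S_e for the partial skew group ring
    of the isotropy group at an object e.  S_e embeds in S as the corner of
    formal sums supported on the isotropy group at e (corner_embed), and the
    element-wise criterion passes between S and this corner.

    From S to the corner: if x and y lie in the corner, then in x t y only the
    part of t that is itself in the corner contributes, since every other
    a delta_g is killed on one side by the composability condition.  So
    x S_e y = 0 implies x S y = 0, and S_e is prime as soon as S is prime and
    A_e is nonzero (corner_prime).  Such an object e exists because S is
    nonzero.

    From the corner to S: group-type, which can be rebased at any object
    (group_type_full), gives for every object f a morphism k from f to e which
    acts as a full isomorphism from A_f to A_e.  Given a nonzero u in S with
    u_g nonzero, multiplying u on the left by a delta_k, with k from r(g) to e,
    and on the right by b delta_l, with l from e to s(g), lands in the corner.
    With local units for a and b the coefficient at k g l is sigma_k(u_g),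
    which is nonzero (compress_neq0).  If x S y = 0 with x and y nonzero, then
    the compressed elements p x q and p' y q' of S_e are nonzero and also
    satisfy (p x q) S_e (p' y q') = 0, because the factor q t p' in the middle
    is absorbed by x S y = 0; hence S_e is not prime (prime_of_corner). *)

(** * Primeness in terms of elements *)

Section PrimeElements.
Variable R : nonAssocRingType.
Implicit Types x y z : R.

Lemma rmul_suml (I : Type) (r : seq I) (F : I -> R) x :
  (\sum_(i <- r) F i) ** x = \sum_(i <- r) F i ** x.
Proof.
by apply: (big_morph (fun y => y ** x)) => [y z|]; rewrite ?rmulDl ?rmul0r.
Qed.

Lemma rmul_sumr (I : Type) (r : seq I) (F : I -> R) x :
  x ** (\sum_(i <- r) F i) = \sum_(i <- r) x ** F i.
Proof.
by apply: (big_morph (rmul x)) => [y z|]; rewrite ?rmulDr ?rmulr0.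
Qed.

(** The clause x y = 0 stands in for t = 1 in x t y = 0; it makes the criterion
    hold without any kind of unit. *)
Definition elementwise_prime := forall x y,
  x ** y = 0 -> (forall t, x ** t ** y = 0) -> x = 0 \/ y = 0.

Lemma nonzero_set (I : set R) x : I x -> x <> 0 -> I <> [set 0].
Proof. by move=> Ix x0 I0; move: Ix; rewrite I0. Qed.

Lemma nonzero_ideal_elt (I : set R) :
  ideal I -> I <> [set 0] -> exists2 x, I x & x <> 0.
Proof.
case=> _ [I0 _] _ nI; apply: contrapT => noelt; apply: nI.
apply/seteqP; split=> x; last by move=> ->.
by move=> Ix; apply: contrapT => x0; apply: noelt; exists x.
Qed.

(** When x y = 0 and x R y = 0, the right annihilator J of x and x R is an ideal
    containing y, and the left annihilator I of J and R J is an ideal containing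
    x, so that I J = 0 without forming any generated ideal. *)
Lemma prime_ringP : associative (@rmul R) ->
  prime_ring R <-> (exists x, x <> 0) /\ elementwise_prime.
Proof.
move=> mulA; split=> -[nz P]; split=> //; last first.
  move=> [I [J [idI idJ nI nJ IJ0]]].
  have [x Ix x0] := nonzero_ideal_elt idI nI.
  have [y Jy y0] := nonzero_ideal_elt idJ nJ.
  have IJ u v : I u -> J v -> u ** v = 0.
    move=> Iu Jv; have : ideal_mul I J (u ** v); last by rewrite IJ0.
    by exists 1, (fun=> u), (fun=> v); split=> //; rewrite big_ord1.
  case: (P x y) => // [|t]; apply: IJ => //.
  by case: idI => _ _ /(_ t x) [].
move=> x y xy0 xty0; apply: contrapT => /not_orP [x0 y0]; apply: P.
pose J := [set v : R | x ** v = 0 /\ forall t, x ** t ** v = 0].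
pose I := [set u : R | forall v, J v -> u ** v = 0 /\ forall t, u ** t ** v = 0].
exists I, J; split.
- split=> //; first split.
  + by move=> v _; split=> [|t]; rewrite !rmul0r.
  + move=> u u' Iu Iu' v Jv; have [uv utv] := Iu _ Jv; have [uv' utv'] := Iu' _ Jv.
    split=> [|t]; rewrite !rmulDl !rmulNr ?uv ?uv' ?subrr //.
    by rewrite utv utv' subrr.
  + move=> b u _ Iu; split=> v Jv; have [uv utv] := Iu _ Jv; split=> [|t].
    * by rewrite -mulA uv rmulr0.
    * by rewrite -!mulA (mulA u) utv rmulr0.
    * exact: utv.
    * by rewrite -(mulA u) utv.
- split=> //; first split.
  + by split=> [|t]; rewrite rmulr0.
  + move=> v v' [xv xtv] [xv' xtv'].
    by split=> [|t]; rewrite rmulDr rmulrN ?xv ?xv' ?xtv ?xtv' subrr.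
  + move=> b v _ [xv xtv]; split; split=> [|t].
    * by rewrite mulA xtv.
    * by rewrite mulA -(mulA x) xtv.
    * by rewrite mulA xv rmul0r.
    * by rewrite mulA xtv rmul0r.
- by apply: nonzero_set x0 => v [].
- exact: nonzero_set y0.
- apply/seteqP; split=> z; last first.
    by move=> ->; exists 0, (fun=> 0), (fun=> 0); split=> [[]//|]; rewrite big_ord0.
  move=> [n [u [v [uv ->]]]] /=; rewrite big1 // => i _.
  by have [Iu Jv] := uv i; case: (Iu _ Jv).
Qed.

End PrimeElements.

(** * Groupoids and partial actions of group-type *)

Lemma gcompK (G : groupoidType) (g h : G) : src g = rng h ->
  gcomp (ginv g) (gcomp g h) = h.
Proof. by move=> gh; rewrite gcompA ?src_inv // gcompVg gh gcomp_rng. Qed.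

Lemma gcompKV (G : groupoidType) (g h : G) : src g = rng h ->
  gcomp (gcomp g h) (ginv h) = g.
Proof. by move=> gh; rewrite -gcompA ?rng_inv // gcompV -gh gcomp_src. Qed.

(** Full ranges compose when sigma_g is defined on all of A_{s(g)}: every a in the ideal at
    r(g) is sigma_g of an element of the ideal at s(g) = r(h), which is all of
    the domain A_h. *)
Lemma pdom_comp_full (G : groupoidType) (A : rngType)
    (sigma : partial_action G A) (g h : G) : src g = rng h ->
    pdom sigma g = pdom sigma (rng g) ->
    pdom sigma (ginv g) = pdom sigma (src g) ->
    pdom sigma h = pdom sigma (rng h) ->
  pdom sigma (gcomp g h) = pdom sigma (rng g).
Proof.
move=> gh Dg DVg Dh; apply/seteqP; split=> a.
  by move=> /pdom_sub; rewrite rng_comp.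
rewrite -Dg => Da; rewrite -(pactKV Da).
have Db := pactV_dom Da.
by apply: pact_dom_comp => //; rewrite Dh -gh -DVg.
Qed.

(** Group-type does not depend on the base object: any two objects e and f are
    joined by h_e h_f^-1, which passes through the given base object and acts
    as an isomorphism of the whole ideal A_f onto the whole ideal A_e. *)
Lemma group_type_full (G : groupoidType) (A : rngType)
    (sigma : partial_action G A) : group_type sigma ->
  forall e f : gobj G, exists k : G,
    [/\ src k = val f, rng k = val e, pdom sigma k = pdom sigma (val e)
      & pdom sigma (ginv k) = pdom sigma (val f)].
Proof.
case=> _ [e0 [h [sh rh _ DVh Dh]]] e f.
have hh (f1 f2 : gobj G) : src (h f1) = rng (ginv (h f2)).
  by rewrite rng_inv !sh.
have D12 f1 f2 : pdom sigma (gcomp (h f1) (ginv (h f2))) = pdom sigma (val f1).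
  by rewrite pdom_comp_full ?rng_inv ?sh ?rh ?Dh ?DVh.
exists (gcomp (h e) (ginv (h f))); split.
- by rewrite src_comp // src_inv rh.
- by rewrite rng_comp // rh.
- exact: D12.
- by rewrite ginv_comp // ginvK D12.
Qed.

(** * Formal sums in the skew groupoid ring *)

Section SkewElements.
Variables (G : groupoidType) (A : rngType) (sigma : partial_action G A).
Local Notation D := (pdom sigma).
Local Notation S := (skew_ring sigma).
Local Notation delta := (skew_delta sigma).
Implicit Types (x y : S) (g h k : G).

Definition coef x g : A := (val x)@_g.

Lemma coefP x y : coef x =1 coef y -> x = y.
Proof. by move=> xy; apply/val_inj/malgP. Qed.

Lemma coefD x y g : coef (x + y) g = coef x g + coef y g.
Proof. exact: mcoeffD. Qed.

Lemma coef0 g : coef 0 g = 0.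
Proof. exact: mcoeff0. Qed.

Lemma coef_sum (I : Type) (r : seq I) (F : I -> S) g :
  coef (\sum_(i <- r) F i) g = \sum_(i <- r) coef (F i) g.
Proof.
by apply: (big_morph (coef^~ g)) => [x y|]; rewrite ?coefD ?coef0.
Qed.

Lemma coef_delta g a k : D g a -> coef (delta g a) k = a *+ (g == k).
Proof. by move=> Da; rewrite /coef val_skew_delta // mcoeffU. Qed.

Lemma coef_neq0 x : x <> 0 -> exists g, coef x g <> 0.
Proof.
move=> x0; apply: contrapT => all0; apply: x0; apply: coefP => g.
by rewrite coef0; apply: contrapT => xg; apply: all0; exists g.
Qed.

Lemma pdom_0 g : D g 0.
Proof. by case: (pdom_add sigma g). Qed.

Lemma delta0 g : delta g 0 = 0.
Proof.
apply: coefP => k; rewrite coef_delta ?mul0rn ?coef0 //; exact: pdom_0.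
Qed.

Lemma deltaM_comp g h a b : src g = rng h -> D g a -> D h b ->
  delta g a ** delta h b = delta (gcomp g h) (skew_coef sigma g h a b).
Proof. by move=> gh Da Db; rewrite skew_deltaM // gh eqxx. Qed.

Lemma deltaM_ncomp g h a b : src g <> rng h -> D g a -> D h b ->
  delta g a ** delta h b = 0.
Proof. by move=> gh Da Db; rewrite skew_deltaM //; case: eqP. Qed.

(** Left and right translation in a groupoid are injective, so among all the
    terms of x only the one at g contributes to the coefficient at k g l. *)
Lemma coef_sandwich x k g l a b :
    src k = rng g -> src g = rng l -> D k a -> D l b ->
  coef (delta k a ** x ** delta l b) (gcomp (gcomp k g) l) =
  skew_coef sigma (gcomp k g) l (skew_coef sigma k g a (coef x g)) b.
Proof.
move=> kg gl Da Db; have Dx h : D h (coef x h) := skew_ringP x h.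
have kgl : src (gcomp k g) = rng l by rewrite src_comp.
have Dc : D (gcomp k g) (skew_coef sigma k g a (coef x g)).
  exact: skew_coef_dom.
have -> : skew_coef sigma (gcomp k g) l (skew_coef sigma k g a (coef x g)) b =
    coef (delta k a ** delta g (coef x g) ** delta l b) (gcomp (gcomp k g) l).
  rewrite !deltaM_comp // coef_delta ?eqxx //; exact: skew_coef_dom.
have off h : h <> g ->
    coef (delta k a ** delta h (coef x h) ** delta l b) (gcomp (gcomp k g) l)
    = 0.
  move=> hg; have [kh|kh] := pselect (src k = rng h); last first.
    by rewrite deltaM_ncomp // rmul0r coef0.
  have Dkh := skew_coef_dom kh Da (Dx h); rewrite deltaM_comp //.
  have [hl|hl] := pselect (src h = rng l); last first.
    by rewrite deltaM_ncomp ?src_comp ?coef0.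
  have khl : src (gcomp k h) = rng l by rewrite src_comp.
  rewrite deltaM_comp // coef_delta; last exact: skew_coef_dom.
  case: eqP => // khlE; case: hg.
  by rewrite -(gcompK kh) -(gcompKV khl) khlE gcompKV // gcompK.
rewrite {1}(skewE x) rmul_sumr rmul_suml coef_sum.
have [gx|gx] := boolP (g \in msupp (val x)).
  rewrite (big_rem g) //= big_seq big1 ?addr0 // => h.
  by rewrite mem_rem_uniq ?fset_uniq // inE => /andP [/eqP /off].
rewrite [coef x g]mcoeff_outdom // delta0 rmulr0 rmul0r coef0.
rewrite big_seq big1 // => h hx; apply: off => hg.
by rewrite hg (negPf gx) in hx.
Qed.

End SkewElements.

(** * The corner at an object *)

Section Corner.
Variables (G : groupoidType) (A : rngType) (sigma : partial_action G A).
Variable e : gobj G.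
Local Notation D := (pdom sigma).
Local Notation S := (skew_ring sigma).
Local Notation delta := (skew_delta sigma).
Local Notation rho := (restriction sigma e).
Local Notation Se := (skew_ring rho).
Implicit Types (x y z : Se) (g h : isotropy e).

Lemma val_obj_sum (I : Type) (r : seq I) (F : I -> obj_ring sigma e) :
  val (\sum_(i <- r) F i) = \sum_(i <- r) val (F i).
Proof. exact: (big_morph val). Qed.

Definition corner_embed x : S :=
  \sum_(g <- msupp (val x)) delta (val g) (val (coef x g)).

Lemma coef_dom x g : D (val g) (val (coef x g)).
Proof. exact: skew_ringP x g. Qed.

Lemma coef_corner_embed x g : coef (corner_embed x) (val g) = val (coef x g).
Proof.
rewrite {2}(skewE x) /corner_embed !coef_sum val_obj_sum.
apply: eq_bigr => h _; rewrite !coef_delta; [|exact: skew_ringP|exact: coef_dom].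
by rewrite (inj_eq val_inj); case: eqP.
Qed.

Lemma coef_corner_embed_out x (k : G) : (forall g, val g <> k) ->
  coef (corner_embed x) k = 0.
Proof.
move=> nk; rewrite coef_sum big1 // => g _.
by rewrite coef_delta; [case: eqP => // /nk|exact: coef_dom].
Qed.

Lemma coef_corner_eq (u v : S) :
  (forall g, coef u (val g) = coef v (val g)) ->
  (forall k, (forall g, val g <> k) -> coef u k = coef v k) -> u = v.
Proof.
move=> uv_in uv_out; apply: coefP => k.
have [[g <-//]|nk] := pselect (exists g, val g = k).
by apply: uv_out => g gk; apply: nk; exists g.
Qed.

Lemma corner_embedD x y : corner_embed (x + y) = corner_embed x + corner_embed y.
Proof.
apply: coef_corner_eq => [g|k nk]; rewrite coefD.
  by rewrite !coef_corner_embed coefD.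
by rewrite !coef_corner_embed_out ?addr0.
Qed.

Lemma corner_embed0 : corner_embed 0 = 0.
Proof.
apply: coef_corner_eq => [g|k nk]; rewrite coef0.
  by rewrite coef_corner_embed coef0.
by rewrite coef_corner_embed_out.
Qed.

Lemma corner_embed_sum (I : Type) (r : seq I) (F : I -> Se) :
  corner_embed (\sum_(i <- r) F i) = \sum_(i <- r) corner_embed (F i).
Proof. exact: (big_morph corner_embed corner_embedD corner_embed0). Qed.

Lemma corner_embed_inj : injective corner_embed.
Proof.
move=> x y xy; apply: coefP => g; apply: val_inj.
by rewrite -!coef_corner_embed xy.
Qed.

Lemma corner_embed_delta g (a : obj_ring sigma e) : D (val g) (val a) ->
  corner_embed (skew_delta rho g a) = delta (val g) (val a).
Proof.
move=> Da; apply: coef_corner_eq => [h|k nk].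
  rewrite coef_corner_embed !coef_delta // (inj_eq val_inj).
  by case: eqP.
by rewrite coef_corner_embed_out // coef_delta //; case: eqP => // /nk.
Qed.

Lemma corner_embed_deltaM g h (a b : obj_ring sigma e) :
    D (val g) (val a) -> D (val h) (val b) ->
  corner_embed (skew_delta rho g a ** skew_delta rho h b) =
  delta (val g) (val a) ** delta (val h) (val b).
Proof.
move=> Da Db.
have gh : src (val g) = rng (val h) by rewrite iso_src iso_rng.
have DVa : D (val (ginv g)) (val (res_act (ginv g) a)).
  by rewrite val_res_act; [exact: pactV_dom|rewrite /res_dom /= ginvK].
have DVab : D (val (ginv g)) (val (res_act (ginv g) a ** b)).
  by have [] := pdom_mul gh DVa Db.
have coefE : val (skew_coef rho g h a b) =
    skew_coef sigma (val g) (val h) (val a) (val b).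
  rewrite /skew_coef /= val_res_act //; congr pact.
  by rewrite /= val_res_act // /res_dom /= ginvK.
have Dc : D (val (gcomp g h)) (val (skew_coef rho g h a b)).
  by rewrite coefE; exact: skew_coef_dom.
rewrite (@deltaM_comp _ _ rho) // corner_embed_delta // coefE.
by rewrite (@deltaM_comp _ _ sigma).
Qed.

(** The products of S_e and S agree on homogeneous elements since the
    coefficients of S_e are elements of A with the same action; biadditivity
    does the rest. *)
Lemma corner_embedM x y : corner_embed (x ** y) = corner_embed x ** corner_embed y.
Proof.
rewrite {1}(skewE x) {1}(skewE y) rmul_suml corner_embed_sum.
rewrite [in RHS]/corner_embed rmul_suml.
apply: eq_bigr => g _; rewrite rmul_sumr corner_embed_sum rmul_sumr.
apply: eq_bigr => h _.
apply: corner_embed_deltaM; exact: coef_dom.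
Qed.

Lemma corner_rmulA : associative (@rmul S) -> associative (@rmul Se).
Proof.
by move=> mulA x y z; apply: corner_embed_inj; rewrite !corner_embedM mulA.
Qed.

Definition in_corner (u : S) := exists z, u = corner_embed z.

Lemma in_corner_sum (I : Type) (r : seq I) (F : I -> S) :
  (forall i, in_corner (F i)) -> in_corner (\sum_(i <- r) F i).
Proof.
move=> cF; apply: big_ind => //; first by exists 0; rewrite corner_embed0.
by move=> _ _ [y ->] [z ->]; exists (y + z); rewrite corner_embedD.
Qed.

Lemma in_corner_delta (k : G) a : src k = val e -> rng k = val e -> D k a ->
  in_corner (delta k a).
Proof.
move=> sk rk Da.
have kP : (src k == val e) && (rng k == val e) by rewrite sk rk eqxx.
have Dea : D (val e) a by rewrite -rk; apply: pdom_sub.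
exists (skew_delta rho (Isotropy kP) (to_ideal (pdom_obj_ideal sigma e) Dea)).
by rewrite corner_embed_delta.
Qed.

Lemma corner_embed_mul_out x (k : G) a : rng k <> val e -> D k a ->
  corner_embed x ** delta k a = 0.
Proof.
move=> rk Da; rewrite rmul_suml big1 // => g _.
apply: deltaM_ncomp => //; last exact: coef_dom.
by rewrite iso_src => /esym.
Qed.

Lemma out_mul_corner_embed x (k : G) a : src k <> val e -> D k a ->
  delta k a ** corner_embed x = 0.
Proof.
move=> rk Da; rewrite rmul_sumr big1 // => g _.
by apply: deltaM_ncomp; [rewrite iso_rng| |exact: coef_dom].
Qed.

(** A homogeneous t that is not in the corner does not compose with corner
    elements on both sides, so it contributes nothing. *)
Lemma corner_embed_annihilate x y : associative (@rmul S) ->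
  (forall t, x ** t ** y = 0) ->
  forall t, corner_embed x ** t ** corner_embed y = 0.
Proof.
move=> mulA xty t; rewrite (skewE t) (rmul_sumr _ _ (corner_embed x)).
rewrite rmul_suml big1 // => k _.
have Dt := skew_ringP t k.
have [rk|rk] := pselect (rng k = val e); last first.
  by rewrite corner_embed_mul_out ?rmul0r.
have [sk|sk] := pselect (src k = val e); last first.
  by rewrite -mulA out_mul_corner_embed ?rmulr0.
have [z ->] := in_corner_delta sk rk Dt.
by rewrite -!corner_embedM xty corner_embed0.
Qed.

Lemma corner_prime : associative (@rmul S) -> D (val e) <> [set 0] ->
  prime_ring S -> prime_ring Se.
Proof.
move=> mulA De0 /(prime_ringP mulA) [_ PS].
apply/prime_ringP; first exact: corner_rmulA; split.
  have [a Da a0] := nonzero_ideal_elt (pdom_obj_ideal sigma e) De0.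
  have [z dz] := in_corner_delta (src_obj e) (rng_obj e) Da.
  exists z => z0; move: (congr1 (@coef _ _ _ ^~ (val e)) dz).
  by rewrite /= z0 corner_embed0 coef0 coef_delta // eqxx.
move=> x y xy0 xty0; case: (PS (corner_embed x) (corner_embed y)).
- by rewrite -corner_embedM xy0 corner_embed0.
- exact: corner_embed_annihilate.
- by rewrite -corner_embed0 => /corner_embed_inj; left.
- by rewrite -corner_embed0 => /corner_embed_inj; right.
Qed.

(** Each term of u either vanishes or becomes a term at a morphism e -> e. *)
Lemma in_corner_sandwich (u : S) (k l : G) (a b : A) :
    rng k = val e -> src l = val e -> D k a -> D l b ->
  in_corner (delta k a ** u ** delta l b).
Proof.
move=> rk sl Da Db; rewrite (skewE u) rmul_sumr rmul_suml.
apply: in_corner_sum => h; have Dh := skew_ringP u h.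
have corner0 : in_corner 0 by exists 0; rewrite corner_embed0.
have [kh|kh] := pselect (src k = rng h); last first.
  by rewrite deltaM_ncomp // rmul0r.
have Dkh := skew_coef_dom kh Da Dh; rewrite deltaM_comp //.
have [khl|khl] := pselect (src (gcomp k h) = rng l); last first.
  by rewrite deltaM_ncomp.
rewrite deltaM_comp //; apply: in_corner_delta; last exact: skew_coef_dom.
  by rewrite src_comp.
by rewrite !rng_comp.
Qed.

Hypothesis s_unital_dom : forall g : G, s_unital (D g).

Hypothesis full_from : forall f : gobj G, exists k : G,
  [/\ src k = val f, rng k = val e, D k = D (val e) & D (ginv k) = D (val f)].

(** The term of u at g is brought into the corner along the full isomorphisms
    from r(g) and s(g) to e.  Fullness of the domains provides coefficients
    that act as local units, so that nothing of u_g is lost. *)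
Lemma compress_neq0 (u : S) : u <> 0 ->
  exists p q z, p ** u ** q = corner_embed z /\ z <> 0.
Proof.
move=> /coef_neq0 [g ug].
have [k [kg rk Dk DVk]] := full_from (Gobj (introT eqP (src_rng g))).
have [l' [gl' rl' Dl' DVl']] := full_from (Gobj (introT eqP (src_src g))).
rewrite /= in kg DVk gl' DVl'.
pose l := ginv l'.
have sl : src l = val e by rewrite src_inv.
have gl : src g = rng l by rewrite rng_inv gl'.
have Du := skew_ringP u g.
have DVku : D (ginv k) (coef u g) by rewrite DVk; apply: pdom_sub.
(* With sigma_k(a) delta_k on the left, the coefficient sigma_k(a u_g) is
   sigma_k(u_g). *)
have [a [_ [Da _ au _]]] := s_unital_dom DVku.
have Dka := pact_dom Da.
pose c := skew_coef sigma k g (pact sigma k a) (coef u g).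
have cE : c = pact sigma k (coef u g) by rewrite /c /skew_coef pactK // au.
have Dc : D (gcomp k g) c by apply: skew_coef_dom.
have c0 : c <> 0 by move=> c0; apply: ug; rewrite -(pactK DVku) -cE c0 pact0.
(* On the right, the coefficient b only meets c after c is pulled back along
   k g, so b has to be a right unit for that pullback d; it can be taken in
   A_l because l has full range. *)
have Dd := pactV_dom Dc; set d := pact _ _ c in Dd.
have Dld : D l d.
  by rewrite DVl' -(src_comp _ _ kg) -rng_inv; apply: pdom_sub.
have [_ [b [_ Db _ db]]] := s_unital_dom Dld.
have [z zE] := in_corner_sandwich u rk sl Dka Db.
exists (delta k (pact sigma k a)), (delta l b), z; split=> // z0; apply: c0.
have := coef_sandwich u kg gl Dka Db.
by rewrite zE z0 corner_embed0 coef0 -/c /skew_coef -/d db pactKV.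
Qed.

Lemma prime_of_corner : associative (@rmul S) ->
  prime_ring Se -> prime_ring S.
Proof.
move=> mulA /(prime_ringP (corner_rmulA mulA)) [[z z0] PSe].
apply/prime_ringP => //; split.
  by exists (corner_embed z); rewrite -corner_embed0 => /corner_embed_inj.
move=> x y xy0 xty0; apply: contrapT => /not_orP [x0 y0].
have [p [q [x' [x'E x'0]]]] := compress_neq0 x0.
have [p' [q' [y' [y'E y'0]]]] := compress_neq0 y0.
(* The middle factors q t p' and q p' are absorbed by x S y = 0. *)
have sandwich t : p ** x ** q ** t ** (p' ** y ** q') = 0.
  have -> : p ** x ** q ** t ** (p' ** y ** q') =
            p ** (x ** (q ** t ** p') ** y) ** q' by rewrite !mulA.
  by rewrite xty0 rmulr0 rmul0r.
have sandwich1 : p ** x ** q ** (p' ** y ** q') = 0.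
  have -> : p ** x ** q ** (p' ** y ** q') =
            p ** (x ** (q ** p') ** y) ** q' by rewrite !mulA.
  by rewrite xty0 rmulr0 rmul0r.
case: (PSe x' y') => // [|t]; apply: corner_embed_inj;
  rewrite corner_embed0 !corner_embedM -x'E -y'E.
  exact: sandwich1.
exact: sandwich.
Qed.

End Corner.

Theorem theorem4p17 (G : groupoidType) (A : rngType)
    (sigma : partial_action G A)
    (s_unital_dom : forall g : G, s_unital (pdom sigma g))
    (direct_sum : object_direct_sum sigma)
    (sigma_group_type : group_type sigma) :
  prime_ring (skew_ring sigma) <->
  exists e : gobj G,
    pdom sigma e <> [set 0] /\ prime_ring (skew_ring (restriction sigma e)).
Proof.
have mulA := skew_rmulA s_unital_dom; split=> [PS|[e [_ PSe]]].
  have [[x /coef_neq0 [g xg]] _] := PS.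
  pose e := Gobj (introT eqP (src_rng g)).
  have De0 : pdom sigma (val e) <> [set 0].
    apply: (nonzero_set _ xg); exact: pdom_sub (skew_ringP x g).
  by exists e; split=> //; apply: corner_prime.
exact: prime_of_corner (group_type_full sigma_group_type e) mulA PSe.
Qed.
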